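(* Let $(X,\rho)$ be a Hadamard space, let $K \subset X$ be a nonempty closed convex set, and let $G : K \rightrightarrows K$ be a set-valued mapping with closed values. Suppose that for every finite subset $D := \{x_1,\dots,x_m\} \subset K$ one has $$\operatorname{co}(D) \subset G(D).$$ Then the family $\{G(x)\}_{x\in K}$ has the finite intersection property. Moreover, if $G(x_0)$ is compact for some $x_0 \in K$, then $\bigcap_{x\in K} G(x) \neq \varnothing$.
   Context: A Hadamard space is a complete CAT(0) space; any two points $x,y$ are joined by a unique geodesic segment. A set is convex if it contains the geodesic segment joining any two of its points, and $\operatorname{co}(E)$ denotes the smallest convex set containing $E$ (no closure is taken). For $D\subset K$, $G(D) := \bigcup_{x\in D} G(x)$. *)

(* Defs.v *)
From HB Require Import structures.
From mathcomp Require Import all_boot all_order all_algebra.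
From mathcomp Require Import all_classical all_reals.
From mathcomp Require Import topology.

Set Implicit Arguments.
Unset Strict Implicit.
Unset Printing Implicit Defensive.

Import Order.TTheory GRing.Theory Num.Theory.

Local Open Scope classical_set_scope.
Local Open Scope ring_scope.

(* The library's complete spaces are pointed; the base point carries no
   mathematical content for a nonempty space. *)
#[short(type="completeMetricType")]
HB.structure Definition CompleteMetric (R : numDomainType) :=
  {T of CompletePseudoMetric R T & Metric R T}.

Section Geodesics.
Context {R : realType} {X : metricType R}.
Implicit Types (x y : X) (c : R -> X) (S C E : set X).

(* The path is parametrized by arc length on [0, mdist x y]; the values of c
   outside this interval are irrelevant. *)
Definition geodesic x y c : Prop :=
  [/\ c 0 = x, c (mdist x y) = y &
      {in `[0, mdist x y] &, forall s t, mdist (c s) (c t) = `|s - t|}].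

Definition geodesic_segment x y S : Prop :=
  exists2 c, geodesic x y c & S = c @` `[0, mdist x y].

Definition geodesically_convex C : Prop :=
  forall x y S, C x -> C y -> geodesic_segment x y S -> S `<=` C.

Definition convex_hull E : set X := smallest geodesically_convex E.

End Geodesics.

Section EuclideanPlane.
Context {R : realType}.
Implicit Types a b : 'rV[R]_2.

(* The norm carried by 'rV[R]_2 in the library is the sup norm, hence this
   explicit Euclidean distance. *)
Definition edist a b : R := Num.sqrt (\sum_i (a 0 i - b 0 i) ^+ 2).

Definition esegment a b : set 'rV[R]_2 :=
  [set (1 - t) *: a + t *: b | t in `[0, 1]].

End EuclideanPlane.

Section CAT0.
Context {R : realType}.

Definition comparison_triangle (X : metricType R) (p q r : X)
    (p' q' r' : 'rV[R]_2) : Prop :=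
  [/\ edist p' q' = mdist p q, edist q' r' = mdist q r &
      edist r' p' = mdist r p].

(* x lies on the side S = [a, b] and x' is its comparison point on [a', b']. *)
Definition comparison_point (X : metricType R) (S : set X) (a : X)
    (a' b' : 'rV[R]_2) (x : X) (x' : 'rV[R]_2) : Prop :=
  [/\ S x, esegment a' b' x' & edist a' x' = mdist a x].

Definition CAT0 (X : metricType R) : Prop :=
  (forall x y : X, exists c, geodesic x y c) /\
  forall (p q r : X) (Spq Sqr Srp : set X) (p' q' r' : 'rV[R]_2),
    geodesic_segment p q Spq -> geodesic_segment q r Sqr ->
    geodesic_segment r p Srp -> comparison_triangle p q r p' q' r' ->
    let on_triangle x x' :=
      [\/ comparison_point Spq p p' q' x x',
          comparison_point Sqr q q' r' x x' |
          comparison_point Srp r r' p' x x'] in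
    forall x y x' y', on_triangle x x' -> on_triangle y y' ->
      mdist x y <= edist x' y'.

End CAT0.

(* Main.v *)
From HB Require Import structures.
From mathcomp Require Import all_boot all_order all_algebra zify ring lra.

(* The intersection property for finitely many points x_0, ..., x_n of K is
   transported to the classical KKM lemma on the standard simplex. Coning
   successively over the x_k along geodesics defines a continuous map g from R^n+1
   to X: geodesics towards a common endpoint do not spread apart in a CAT(0)
   space. If v is a point of the simplex then g v lies in the convex hull of the
   x_k with v_k > 0, so the closed sets g^-1 (G x_k) satisfy the KKM hypothesis.

   The KKM lemma itself is obtained from a labelling of finer and finer grids.
   Instead of a triangulation, the Sperner-type parity argument uses Scarf's
   primitive sets, in the formulation of Petri and Voorneveld: given finitely many
   linear orders on a finite set, a set S is dominant if every point lies, in at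
   least one of the orders, weakly above all of S. *)

Set Implicit Arguments.
Unset Strict Implicit.
Unset Printing Implicit Defensive.

(** * Completing dominant sets *)

Lemma imset_setD1_collision (aT rT : finType) (f : aT -> rT) (D : {set aT})
    x y : y \in D -> x != y -> f x = f y -> f @: (D :\ x) = f @: D.
Proof.
move=> yD xy fxy; apply/eqP; rewrite eqEsubset imsetS ?subD1set //=.
apply/subsetP => _ /imsetP[z zD ->]; have [->|zx] := eqVneq z x.
  by rewrite fxy imset_f // !inE eq_sym xy.
by rewrite imset_f // !inE zx.
Qed.

Section Dominance.
Variables (N V : finType) (r : N -> V -> nat).
Hypothesis r_inj : forall i, injective (r i).
Implicit Types (S : {set V}) (v s t : V) (i j : N).

Definition dominant S :=
  [forall v, [exists i, [forall s in S, r i s <= r i v]]].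

Lemma dominantP S :
  reflect (forall v, exists i, {in S, forall s, r i s <= r i v}) (dominant S).
Proof.
apply: (iffP forallP) => domS v.
  by have /existsP[i /forall_inP ?] := domS v; exists i.
by have [i ?] := domS v; apply/existsP; exists i; apply/forall_inP.
Qed.

Lemma dominantW S S' : S \subset S' -> dominant S' -> dominant S.
Proof.
move=> /subsetP sSS' /dominantP domS'; apply/dominantP => v.
by have [i le_v] := domS' v; exists i => s /sSS'/le_v.
Qed.

(** By dominance each element of [S] is the maximum of [S] in some order. A completion must keep
    this true and be itself maximal in some order, which forces it to be the lowest eligible point
    for one of two particular orders. The last hypothesis makes eligible points exist. *)
Lemma completions2 S : S != set0 -> dominant S -> #|S|.+1 = #|N| ->
    (forall i, exists t, forall j, j != i -> exists2 s, s \in S & r j t < r j s) ->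
  #|[set t | t \notin S & dominant (t |: S)]| = 2.
Proof.
move=> /set0Pn[s0 s0S] /dominantP domS cardS Mn0.
pose m i := [arg max_(s > s0 in S) r i s].
have mS i : m i \in S by rewrite /m; case: arg_maxnP.
have m_max i s : s \in S -> r i s <= r i (m i).
  by rewrite /m; case: arg_maxnP => // ? _; apply.
have mE i s : {in S, forall s', r i s' <= r i s} -> s \in S -> s = m i.
  move=> le_s sS; apply/(@r_inj i)/eqP.
  by rewrite eqn_leq m_max // le_s.
have m_surj : m @: setT = S.
  apply/setP => s; apply/imsetP/idP => [[i _ ->]//|sS].
  by have [i le_s] := domS s; exists i => //; apply: mE.
have cardm : #|[set: N]| = #|m @: setT|.+1 by rewrite m_surj cardsT.
(* The order maxima m i exhaust S and collide exactly once, at i1 and i2; a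
   completion restores injectivity by taking over the maximum for i1 or for i2. *)
have [i1 [i2 [i12 m12]]] : exists i1 i2, i1 != i2 /\ m i1 = m i2.
  have /injectivePn[i1 [i2 i12 m12]] : ~~ injectiveb m.
    by apply/injectiveP => m_inj; move: cardm; rewrite card_imset //; lia.
  by exists i1, i2.
have i21 : i2 != i1 by rewrite eq_sym.
(* Dominance of [S] can hold at such a [t] only through the order [i]. *)
pose inM i t := [forall (j | j != i), [exists s in S, r j t < r j s]].
have inMP i t j : inM i t -> j != i -> {in S, forall s, r j s <= r j t} -> False.
  move=> /forall_inP/(_ j) Mt /Mt/exists_inP[s sS lt_ts] /(_ s sS).
  by rewrite leqNgt lt_ts.
(* The default [s0] is never reached, by [Mn0]. *)
pose tau i := if [pick t | inM i t] is Some t0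
  then [arg min_(t < t0 | inM i t) r i t] else s0.
have tauP i : inM i (tau i) /\ forall t, inM i t -> r i (tau i) <= r i t.
  rewrite /tau; case: pickP => [t0 Mt0|M0].
    by case: arg_minnP.
  have [t Mt] := Mn0 i; have := M0 t; case/negP; apply/forall_inP => j /Mt[s sS lts].
  by apply/exists_inP; exists s.
pose t1 := tau i1; pose t2 := tau i2.
have key i i' : i != i' -> m i = m i' ->
    tau i \notin S /\ dominant (tau i |: S).
  move=> ii' mii'; have [Mt t_min] := tauP i; split.
    apply/negP => tS; have : tau i \in m @: (setT :\ i).
      by rewrite (imset_setD1_collision _ ii') // m_surj.
    case/imsetP => j; rewrite !inE andbT => ji tE.
    apply: (inMP _ _ _ Mt ji) => s sS; rewrite [in leqRHS]tE.
    exact: m_max.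
  (* Where [inM i v] holds, minimality of [tau i] decides. Any other [v] lies above all of [S],
     hence above [tau i], in some order other than [i]. *)
  apply/dominantP => v; have [Mv|] := boolP (inM i v).
    have [j le_v] := domS v.
    have [ji|ji] := eqVneq j i; last by have := inMP _ _ _ Mv ji le_v.
    rewrite ji in le_v; exists i => s; rewrite !inE => /orP[/eqP->|];
      last exact: le_v.
    exact: t_min.
  case/forall_inPn => j ji /exists_inPn le_v; exists j => s.
  have {}le_v s' : s' \in S -> r j s' <= r j v by move=> /le_v; rewrite -leqNgt.
  rewrite !inE => /orP[/eqP->|]; last exact: le_v.
  have /forall_inP/(_ j ji)/exists_inP[s' s'S lts] := Mt.
  exact: leq_trans (ltnW lts) (le_v _ s'S).
have t12 : t1 != t2.
  apply/eqP => E; have [j le_t] := domS t1.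
  have [M1 _] := tauP i1; have [M2 _] := tauP i2; rewrite -/t1 -/t2 in M1 M2.
  have [ji|ji] := eqVneq j i1; last by have := inMP _ _ _ M1 ji le_t.
  by rewrite ji in le_t; rewrite -E in M2; have := inMP _ _ _ M2 i12 le_t.
suff -> : [set t | t \notin S & dominant (t |: S)] = [set t1; t2].
  by rewrite cards2 t12.
have [t1S dom1] := key _ _ i12 m12; have [t2S dom2] := key _ _ i21 (esym m12).
apply/setP => t; rewrite !inE; apply/andP/orP; last first.
  by case=> /eqP->.
move=> [tS /dominantP domt].
have [i le_t] := domt t.
have sub_le j v : {in t |: S, forall s, r j s <= r j v} ->
    {in S, forall s, r j s <= r j v}.
  by move=> le_v s sS; apply: le_v; rewrite !inE sS orbT.
(* If [t] is above [S] in all orders of [J], the elements of [S] can be maximal in [t |: S] only in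
   orders outside [J]. Counting then leaves at most one order in [J]. *)
have subS (J : {set N}) : (forall j, j \in J -> {in S, forall s, r j s <= r j t}) ->
    S \subset m @: ~: J.
  move=> le_J; apply/subsetP => s sS; have [j le_s] := domt s.
  have sE := mE j s (sub_le j s le_s) sS.
  rewrite sE imset_f // inE; apply/negP => /le_J/(_ _ sS) le_st.
  suff st : s = t by rewrite -st sS in tS.
  by apply/(@r_inj j)/eqP; rewrite eqn_leq le_st le_s // !inE eqxx.
have cardJ (J : {set N}) : (forall j, j \in J -> {in S, forall s, r j s <= r j t}) ->
    #|J| <= 1.
  move=> /subS/subset_leq_card/leq_trans/(_ (leq_imset_card _ _)).
  by have := cardsC J; lia.
have {}le_t := sub_le _ _ le_t.
have Mt : inM i t.
  apply/forall_inP => j ji; apply/exists_inP.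
  apply/exists_inP/contraT => /exists_inPn ge_t.
  suff : #|[set i; j]| <= 1 by rewrite cards2 eq_sym ji.
  apply: cardJ => k; rewrite !inE => /orP[]/eqP-> // s /ge_t.
  by rewrite -leqNgt.
(* Otherwise [m], restricted to the orders other than [i], would still be onto [S], hence injective
   by cardinality, against the collision at [i1] and [i2]. *)
have i12E : (i == i1) || (i == i2).
  apply/contraT; rewrite negb_or => /andP[ii1 ii2].
  have : #|m @: ~: [set i]| == #|~: [set i]|.
    rewrite eqn_leq leq_imset_card /=.
    rewrite cardsC1 -cardS; apply/subset_leq_card/subS => j.
    by rewrite inE => /eqP->.
  move/imset_injP => /(_ i1 i2); rewrite !inE !(eq_sym _ i) => /(_ ii1 ii2 m12) i12'.
  by rewrite i12' eqxx in i12.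
suff tE : t = tau i by case/orP: i12E => /eqP iE; rewrite tE iE eqxx; [left|right].
have [Mtau tau_min] := tauP i.
(* Minimality gives one inequality, dominance of [t |: S] at [tau i] the other. *)
apply/(@r_inj i)/eqP; rewrite eqn_leq tau_min // andbT.
have [j le_tau] := domt (tau i).
have [ji|ji] := eqVneq j i.
  by rewrite ji in le_tau; apply: le_tau; rewrite !inE eqxx.
by have := inMP _ _ _ Mtau ji (sub_le _ _ le_tau).
Qed.
End Dominance.

(** * Sperner-type parity argument *)

(** The count is 0 or 2: if dropping [t] leaves all labels but [i0], then [t] shares its label with
    exactly one other element, and these two are the only ones that may be dropped. *)
Lemma collision_parity (N V : finType) (l : V -> N) (i0 : N) (F : {set V}) :
    #|F| = #|N| -> l @: F != setT ->
  ~~ odd #|[set t in F | l @: (F :\ t) == [set~ i0]]|.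
Proof.
move=> cardF lF; set A := [set _ in _ | _].
have [->|/set0Pn[t]] := eqVneq A set0; first by rewrite cards0.
rewrite inE => /andP[tF /eqP lFt].
have lti0 : l t != i0.
  apply: contraNneq lF => lt; rewrite -(setD1K tF) imsetU1 lFt lt.
  by apply/eqP/setP => i; rewrite !inE orbN.
have : l t \in l @: (F :\ t) by rewrite lFt !inE.
case/imsetP => t'; rewrite !inE => /andP[t't t'F] ltt'.
have tt' : t != t' by rewrite eq_sym.
have cardlF : #|F| = #|l @: F|.+1.
  rewrite -(imset_setD1_collision t'F tt' ltt') lFt cardsC1 cardF prednK //.
  by apply/card_gt0P; exists i0.
suff -> : A = [set t; t'] by rewrite cards2 tt'.
apply/setP => s; rewrite !inE; apply/andP/orP; last first.
  case=> /eqP->; first by rewrite tF lFt eqxx.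
  rewrite t'F (imset_setD1_collision tF t't (esym ltt')).
  by rewrite -(imset_setD1_collision t'F tt' ltt') lFt eqxx.
move=> [sF /eqP lFs]; apply/orP/contraT; rewrite negb_or => /andP[st st'].
have /imset_injP/(_ t t') : #|l @: (F :\ s)| == #|F :\ s|.
  have cardN : 0 < #|N| by apply/card_gt0P; exists i0.
  by rewrite lFs cardsC1 -cardF; have := cardsD1 s F; rewrite sF; lia.
by rewrite !inE ![_ == s]eq_sym st st' => /(_ tF t'F ltt') E; rewrite E eqxx in tt'.
Qed.

Lemma odd_sum (I : finType) (P : pred I) (F : I -> nat) :
  odd (\sum_(i | P i) F i) = \big[addb/false]_(i | P i) odd (F i).
Proof. exact: (big_morph odd oddD). Qed.

(* Counting the pairs (ridge labelled by all of N but i0, facet containing it)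
   in two ways. *)
Lemma sperner (N V : finType) (dom : pred {set V}) (l : V -> N) (i0 : N)
    (S0 : {set V}) :
    (forall S S' : {set V}, S \subset S' -> dom S' -> dom S) ->
    (forall S, dom S -> l @: S = [set~ i0] -> #|S|.+1 = #|N| ->
      odd #|[set t | t \notin S & dom (t |: S)]| = (S == S0)) ->
    dom S0 -> l @: S0 = [set~ i0] -> #|S0|.+1 = #|N| ->
  exists2 S, dom S & l @: S = setT.
Proof.
move=> domW ridge domS0 lS0 cardS0.
have [/existsP[S /andP[? /eqP]]|] :=
    boolP [exists S : {set V}, dom S && (l @: S == setT)]; first by exists S.
rewrite negb_exists => /forallP nodom.
pose door S := [&& dom S, l @: S == [set~ i0] & #|S|.+1 == #|N|].
pose facet S := dom S && (#|S| == #|N|).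
(* [S0] is the only door with an odd number of completions, so the total is odd; without a fully
   labelled dominant set every facet would contribute an even number. *)
have : odd (\sum_(S | door S) #|[set t | t \notin S & dom (t |: S)]|).
  rewrite odd_sum (bigD1 S0) /=; last by rewrite /door domS0 lS0 cardS0 !eqxx.
  rewrite ridge // eqxx big1 // => S /andP[/and3P[domS /eqP lS /eqP cardS]].
  by rewrite ridge // => /negbTE.
suff -> : \sum_(S | door S) #|[set t | t \notin S & dom (t |: S)]| =
    \sum_(F | facet F) #|[set t in F | l @: (F :\ t) == [set~ i0]]|.
  rewrite odd_sum big1 // => F /andP[domF /eqP cardF]; apply/negbTE.
  by apply: collision_parity => //; have := nodom F; rewrite domF.
under eq_bigr do rewrite -sum1_card; under [RHS]eq_bigr do rewrite -sum1_card.
rewrite !pair_big_dep /=.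
rewrite (reindex_onto (fun p => (p.1 :\ p.2, p.2)) (fun p => (p.2 |: p.1, p.2))) /=.
  apply: eq_bigl => -[F t] /=; rewrite !inE eqxx /=.
  rewrite /door /facet xpair_eqE eqxx andbT.
  have [tF|tF] := boolP (t \in F); last first.
    rewrite !andbF /=; apply/negbTE; rewrite !negb_and; apply/orP; right.
    by apply: contraNneq tF => <-; rewrite setU11.
  rewrite setD1K // eqxx andbT /=.
  have [domF|] := boolP (dom F); last by rewrite !andbF.
  rewrite (domW _ _ (subD1set F t)) // andbT /=.
  by rewrite (cardsD1 t F) tF andbC.
case=> S t /=; rewrite inE => /andP[_ /andP[tS _]].
by rewrite setU1K.
Qed.

(** * Slack elements as the boundary *)

Section Slacks.
Variables (N T : finType) (r : N -> T -> nat).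
Hypothesis r_inj : forall i, injective (r i).
Implicit Types (i j : N) (s t : T).

Let n := size (enum N).
Let pos j := index j (enum N).

(* The slack [inl j] ranks above every point in the j-th order and below every
   point in the other orders. *)
Definition slack_rank i (v : N + T) : nat :=
  match v with
  | inl j => if j == i then (n + \max_t r i t).+1 else pos j
  | inr t => n + r i t
  end.

Lemma pos_lt i : pos i < n.
Proof. by rewrite index_mem mem_enum. Qed.

Lemma slack_rank_max i v : slack_rank i v <= slack_rank i (inl i).
Proof.
rewrite /= eqxx; case: v => [j|t] /=.
  by case: eqVneq => // _; have := pos_lt j; lia.
have : r i t <= \max_t r i t by exact: leq_bigmax.
by lia.
Qed.

Lemma slack_rank_inj i : injective (slack_rank i).
Proof.
have max_t t : r i t <= \max_t r i t by exact: leq_bigmax.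
case=> [j|t] [k|s] /=.
- case: (eqVneq j i) => [->|ji]; case: (eqVneq k i) => [->|ki] //.
  + by have := pos_lt k; lia.
  + by have := pos_lt j; lia.
  + by move=> /index_inj ->; rewrite ?mem_enum.
- by case: (j == i); [have := max_t s | have := pos_lt j]; lia.
- by case: (k == i); [have := max_t t | have := pos_lt k]; lia.
- by move/addnI/r_inj ->.
Qed.

Lemma slack_rank_lt i j t : j != i -> slack_rank i (inl j) < slack_rank i (inr t).
Proof. by move=> /negbTE /= ->; have := pos_lt j; lia. Qed.

Lemma slack_rank_gt i t : slack_rank i (inr t) < slack_rank i (inl i).
Proof. by rewrite ltn_neqAle slack_rank_max andbT (inj_eq (@slack_rank_inj i)). Qed.

(** At a point [s], an order [i] other than [i0] fails because the slack of [i] ranks above [s].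
    Only [i0] remains, where the slacks present rank below all points. *)
Lemma dominant_slacks i0 t :
  dominant slack_rank (inr t |: inl @: [set~ i0]) = [forall s, r i0 t <= r i0 s].
Proof.
apply/(dominantP slack_rank)/forallP => [dom s|t_min [j|s]].
- have [i le_s] := dom (inr s); have [ii0|ii0] := eqVneq i i0.
    by rewrite -(leq_add2l n) -ii0; apply: (le_s (inr t)); rewrite setU11.
  have := le_s (inl i).
  by rewrite leqNgt slack_rank_gt !inE imset_f ?inE // orbT => /(_ isT).
- by exists j => v _; exact: slack_rank_max.
- exists i0 => v; rewrite !inE => /orP[/eqP->|/imsetP[j]] /=.
    by rewrite leq_add2l.
  by rewrite !inE => ji0 ->; apply/ltnW/slack_rank_lt.
Qed.

Lemma full_slacks_not_dominant t : ~~ dominant slack_rank (inl @: [set: N]).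
Proof.
apply/negP => /(dominantP slack_rank)/(_ (inr t))[i /(_ (inl i))].
by rewrite leqNgt slack_rank_gt imset_f // => /(_ isT).
Qed.

(* [e j] plays the part of the j-th vertex of the simplex,
   and [e_lt] says that points labelled i lie off the facet opposite to
   vertex i. *)
Lemma rainbow_dominant (l : T -> N) (t0 : T) (e : N -> T)
    (e_lt : forall i j t, j != i -> l t = i -> r i (e j) < r i t) :
  exists d : N -> T, (forall i, l (d i) = i) /\
    forall t, exists i, forall j, r i (d j) <= r i t.
Proof.
pose i0 := l t0; pose l' v := match v with inl j => j | inr t => l t end.
pose S0 : {set N + T} := inl @: [set~ i0].
pose tm := [arg min_(t < t0) r i0 t].
have tm_min : [forall s, r i0 tm <= r i0 s].
  by apply/forallP => s; rewrite /tm; case: arg_minnP => // t _; apply.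
have domS0 : dominant slack_rank S0.
  by apply: (@dominantW _ _ _ _ (inr tm |: S0)); rewrite ?subsetU1 ?dominant_slacks.
have lS0 : l' @: S0 = [set~ i0] by rewrite -imset_comp imset_id.
have cardS0 : #|S0|.+1 = #|N|.
  rewrite card_imset; last exact: inl_inj.
  by rewrite cardsC1 prednK //; apply/card_gt0P; exists i0.
(* The one missing slack cannot be added, since all slacks together are not dominant; this makes
   [S0] the odd ridge. *)
have complS0 : [set t | t \notin S0 & dominant slack_rank (t |: S0)] = [set inr tm].
  apply/setP => -[j|t]; rewrite !inE.
    apply/negbTE; rewrite negb_and negbK /S0.
    have [->|ji0] := eqVneq j i0; last by rewrite imset_f ?inE.
    by rewrite -imsetU1 setUCr full_slacks_not_dominant ?orbT.
  rewrite dominant_slacks (inj_eq inr_inj).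
  have -> /= : inr t \notin S0 by apply/negP => /imsetP[].
  apply/forallP/eqP => [t_min|-> s]; last exact: (forallP tm_min).
  by apply/(@r_inj i0)/eqP; rewrite eqn_leq t_min (forallP tm_min).
have [|S domS lS] := sperner (@dominantW _ _ slack_rank) _ domS0 lS0 cardS0.
  move=> S domS lS cardS.
  (* A ridge containing a point falls under [completions2], the slack of [i] being low in all orders
     but [i]. A ridge of slacks alone is determined by its labels and equals [S0]. *)
  have [/exists_inP[v vS]|noT] :=
    boolP [exists v in S, if v is inr _ then true else false].
    case: v vS => // t tS _.
    rewrite completions2 //; first last.
    - move=> i; exists (inl i) => j ji; exists (inr t) => //.
      by apply: slack_rank_lt; rewrite eq_sym.
    - by apply/set0Pn; exists (inr t).
    - exact: slack_rank_inj.
    by apply/esym/eqP => SE; move: tS; rewrite SE => /imsetP[].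
  have -> : S = S0.
    apply/setP => -[j|t]; last first.
      rewrite (_ : inr t \in S0 = false); last by apply/imsetP => -[].
      apply/negbTE; apply: contra noT => tS.
      by apply/exists_inP; exists (inr t).
    rewrite mem_imset; last exact: inl_inj.
    rewrite -lS; apply/idP/imsetP => [jS|[[k|t] vS /= jE]]; first by exists (inl j).
      by rewrite jE.
    by case/negP: noT; apply/exists_inP; exists (inr t).
  by rewrite complS0 cards1 eqxx.
have {}domS := dominantP _ _ domS.
(* Dominance at [e j] would hold through some order [i], but [S] has an element labelled [i]
   strictly above [e j] in that order: the slack of [i], or a point by [e_lt]. *)
have noslack j : inl j \notin S.
  apply/negP => jS; have [i le_ej] := domS (inr (e j)).
  have [ij|ij] := eqVneq j i.
    by rewrite ij in jS; have := le_ej _ jS; rewrite leqNgt ij slack_rank_gt.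
  have : i \in l' @: S by rewrite lS.
  case/imsetP => -[k|t] vS /= iE; have := le_ej _ vS; rewrite leqNgt; case/negP.
    by rewrite -iE slack_rank_gt.
  by rewrite /= ltn_add2l e_lt.
have /fin_all_exists2[d dS ld] : forall i, exists2 t, inr t \in S & l t = i.
  move=> i; have : i \in l' @: S by rewrite lS.
  by case/imsetP => -[k|t] vS /= iE; [case/negP: (noslack k) | exists t].
exists d; split => // t; have [i le_t] := domS (inr t).
by exists i => j; have := le_t _ (dS j); rewrite /= leq_add2l.
Qed.
End Slacks.

(** * The KKM lemma on an integer grid *)

Lemma sum_below (I : finType) (b : {ffun I -> nat}) (M : nat) :
    M <= \sum_i b i ->
  exists2 t : {ffun I -> nat}, \sum_i t i = M & forall i, t i <= b i.
Proof.
have [m] := ubnP (\sum_i b i); elim: m b => // m IH b ltm.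
rewrite leq_eqVlt => /orP[/eqP->|ltM]; first by exists b.
have [i bi] : exists i, 0 < b i.
  apply/existsP; apply: contraTT ltM; rewrite negb_exists => /forallP b0.
  by rewrite big1 // => i _; have := b0 i; case: (b i).
pose b' := [ffun j => if j == i then (b i).-1 else b j].
have sumb' : (\sum_j b' j).+1 = \sum_j b j.
  rewrite (bigD1 i) //= [RHS](bigD1 i) //= ffunE eqxx -addSn prednK //.
  by congr (_ + _); apply: eq_bigr => j /negbTE ji; rewrite ffunE ji.
have [||t sumt tb'] := IH b'; [by lia|by lia|].
exists t => // j; apply: leq_trans (tb' j) _; rewrite ffunE.
by case: eqVneq => // ->; lia.
Qed.

(** The coordinate orders turn dominance into closeness: no grid point is strictly below the
    coordinatewise maximum of the [d j] in every coordinate, so this maximum has total at most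
    [M + n], while each [d j] has total [M]. *)
Lemma grid_kkm (n M : nat) (l : {ffun 'I_n.+1 -> nat} -> 'I_n.+1) :
    (forall t : {ffun 'I_n.+1 -> nat}, \sum_i t i = M -> 0 < t (l t)) ->
  exists d : 'I_n.+1 -> {ffun 'I_n.+1 -> nat},
    (forall i, \sum_k d i k = M /\ l (d i) = i) /\
    (forall i j k, d i k <= d j k + n).
Proof.
move=> l_pos.
pose T : finType := {t : {ffun 'I_n.+1 -> 'I_M.+1} | \sum_i t i == M}.
pose val_nat (t : T) : {ffun 'I_n.+1 -> nat} := [ffun i => sval t i : nat].
have val_sum t : \sum_i val_nat t i = M.
  by under eq_bigr do rewrite ffunE; apply/eqP/(svalP t).
have lift_nat (t : {ffun 'I_n.+1 -> nat}) : \sum_i t i = M ->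
    exists s, val_nat s = t.
  move=> sumt; have t_le i : t i < M.+1 by rewrite ltnS -sumt (bigD1 i) //= leq_addr.
  pose f : {ffun 'I_n.+1 -> 'I_M.+1} := [ffun i => Ordinal (t_le i)].
  have sumf : \sum_i f i == M by under eq_bigr do rewrite ffunE /=; rewrite sumt.
  exists (exist (fun f : {ffun 'I_n.+1 -> 'I_M.+1} => is_true (\sum_i f i == M))
    f sumf).
  by apply/ffunP => i; rewrite !ffunE.
pose K := size (enum T); pose pos t := index t (enum T).
have pos_lt t : pos t < K by rewrite index_mem mem_enum.
(* Lexicographic: the coordinate first, ties broken by position, as [pos t < K]. *)
pose r (i : 'I_n.+1) (t : T) := val_nat t i * K + pos t.
have r_le i s t : r i s <= r i t -> val_nat s i <= val_nat t i.
  apply: contraTT; rewrite -!ltnNge /r => lt_ts.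
  by have := pos_lt t; nia.
have r_inj i : injective (r i).
  move=> s t E; have vE : val_nat s i = val_nat t i.
    by apply/eqP; rewrite eqn_leq !r_le ?E.
  by move: E; rewrite /r vE => /addnI/index_inj ->; rewrite ?mem_enum.
have vertex j : exists s, val_nat s = [ffun k => if k == j then M else 0].
  apply: lift_nat; under eq_bigr do rewrite ffunE.
  by rewrite -big_mkcond big_pred1_eq.
have [e eE] := fin_all_exists vertex.
have [t0 _] := vertex ord0.
have e_lt i j t : j != i -> l (val_nat t) = i -> r i (e j) < r i t.
  move=> ji lt; rewrite /r eE ffunE eq_sym (negbTE ji).
  have := l_pos _ (val_sum t); rewrite lt; have := pos_lt (e j).
  by nia.
have [d [ld d_dom]] := rainbow_dominant r_inj t0 e_lt.
exists (val_nat \o d); split=> [i|]; first by split; [exact: val_sum | exact: ld].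
pose a k := \max_j val_nat (d j) k.
have le_a j k : val_nat (d j) k <= a k by exact: leq_bigmax.
(* Positivity makes the predecessors below exact, so that lowering all [n.+1] maxima by one costs
   exactly [n.+1]. *)
have a_gt0 k : 0 < a k by apply: leq_trans (le_a k k); rewrite -{2}(ld k) l_pos.
have suma : \sum_k (a k).-1 < M.
  rewrite ltnNge; apply/negP => leM.
  have [|t sumt t_lt] := @sum_below _ [ffun k => (a k).-1] M.
    by under eq_bigr do rewrite ffunE.
  have [s sE] := lift_nat _ sumt; have [i le_s] := d_dom s.
  have : a i <= t i by apply/bigmax_leqP => j _; rewrite -sE r_le.
  by have := t_lt i; rewrite ffunE; have := a_gt0 i; lia.
have {}suma : \sum_k a k <= M + n.
  under eq_bigr do rewrite -(prednK (a_gt0 _)) -addn1.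
  by rewrite big_split /= sum1_card card_ord addnS -addSn leq_add2r.
move=> i j k /=; apply: leq_trans (le_a i k) _.
rewrite -(leq_add2r (\sum_(m | m != k) val_nat (d j) m)) addnAC.
have <- : \sum_m val_nat (d j) m =
    val_nat (d j) k + \sum_(m | m != k) val_nat (d j) m by rewrite (bigD1 k).
rewrite val_sum; apply: leq_trans suma; rewrite [leqRHS](bigD1 k) //= leq_add2l.
by apply: leq_sum => m _; exact: le_a.
Qed.

(* The KKM lemma on the standard simplex *)
From mathcomp Require Import finmap all_classical all_reals interval_inference.
From mathcomp Require Import topology normedtype.
Require Import Defs.

Import Order.TTheory GRing.Theory Num.Theory.
Import numFieldNormedType.Exports.

Local Open Scope classical_set_scope.
Local Open Scope ring_scope.

(** Grids of mesh [1 / M.+1] give points of all the [F i] whose coordinates differ by at most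
    [n / M.+1]. A cluster point of those for [ord0] is therefore a cluster point for every [i]. *)
Lemma kkm (R : realType) (n : nat) (F : 'I_n.+1 -> set 'rV[R]_n.+1) :
    (forall i, closed (F i)) ->
    (forall v : 'rV[R]_n.+1, (forall i, 0 <= v ord0 i) -> \sum_i v ord0 i = 1 ->
      exists2 i, 0 < v ord0 i & F i v) ->
  exists v, forall i, F i v.
Proof.
move=> Fcl Fcover.
pose pt M (t : {ffun 'I_n.+1 -> nat}) : 'rV[R]_n.+1 := \row_k ((t k)%:R / M.+1%:R).
have grid M : exists d : 'I_n.+1 -> {ffun 'I_n.+1 -> nat},
    [/\ forall i, F i (pt M (d i)), forall i k, (d i k <= M.+1)%N &
      forall i j k, (d i k <= d j k + n)%N].
  pose l (t : {ffun 'I_n.+1 -> nat}) :=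
    xget ord0 [set i | (0 < t i)%N /\ F i (pt M t)].
  have lP (t : {ffun 'I_n.+1 -> nat}) :
      (\sum_i t i = M.+1)%N -> (0 < t (l t))%N /\ F (l t) (pt M t).
    move=> sumt; apply: (@xgetPex _ ord0 [set i | (0 < t i)%N /\ F i (pt M t)]).
    have [i|| i ti Fi] := Fcover (pt M t).
    - by rewrite mxE divr_ge0.
    - under eq_bigr do rewrite mxE.
      by rewrite -mulr_suml -natr_sum sumt divff ?pnatr_eq0.
    - by exists i; split => //; move: ti; rewrite mxE pmulr_lgt0 ?invr_gt0 ?ltr0n.
  have [d [dP d_close]] := @grid_kkm n M.+1 l (fun t sumt => (lP t sumt).1).
  exists d; split => // i; first by have [/lP[_]] := dP i => /[swap] ->.
  by move=> k; have [<- _] := dP i; rewrite (bigD1 k) //= leq_addr.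
have [d dP] := choice grid.
pose C := [set v : 'rV[R]_n.+1 | forall i, `[0, 1]%classic (v ord0 i)].
have Ccompact : compact C.
  apply: (@rV_compact R n.+1 (fun=> `[0, 1]%classic)) => i.
  exact: segment_compact.
have uC : \forall M \near \oo, C (pt M (d M ord0)).
  apply: nearW => M k; have [_ d_le _] := dP M.
  by rewrite /= in_itv /= mxE divr_ge0 //= ler_pdivrMr ?mul1r ?ler_nat // ltr0n.
have [v [_ vcl]] := Ccompact _ (fmap_proper_filter _ _) uC.
exists v => i; apply: Fcl => B /nbhs_ballP[e /= e0 vB].
(* Half of [e] goes to the cluster point, half to the passage from [d M ord0] to [d M i]. Dividing
   by [n.+1] rather than [n] covers [n = 0]. *)
have eS0 : 0 < e / 2 / n.+1%:R by rewrite !divr_gt0.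
have e20 : 0 < e / 2 by rewrite divr_gt0.
have largeM : \forall M \near \oo, M.+1%:R^-1 < e / 2 / n.+1%:R.
  exact: (near_infty_natSinv_lt (PosNum eS0)).
have [|_ [[M Me <-] [_ vM]]] := vcl
    [set pt M (d M ord0) | M in [set M | M.+1%:R^-1 < e / 2 / n.+1%:R]] _ _
    (nbhsx_ballx v _ e20).
  by apply: filterS largeM => M /= Me; exists M.
have [Fd d_le d_close] := dP M; exists (pt M (d M i)); split; first exact: Fd.
apply: vB; split => // a k; rewrite [e]splitr.
apply: ball_triangle (vM a k) _; rewrite /ball /= !mxE -mulrBl.
rewrite normrM normfV (ger0_norm (ler0n _ _)).
apply: (@le_lt_trans _ _ (n.+1%:R * M.+1%:R^-1)); last first.
  by rewrite mulrC -ltr_pdivlMr ?ltr0n.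
rewrite ler_wpM2r ?invr_ge0 //.
have := d_close ord0 i k; have := d_close i ord0 k.
set p := d M ord0 k; set q := d M i k => qp pq.
rewrite ler_distl lerBlDr -!natrD !ler_nat.
by apply/andP; split; lia.
Qed.

(** * Comparison triangles in the Euclidean plane *)

Section EuclideanComparison.
Context {R : realType}.
Implicit Types a b c s t : R.

Lemma edistZ s (v w : 'rV[R]_2) : edist (s *: v) (s *: w) = `|s| * edist v w.
Proof.
rewrite /edist -sqrtr_sqr -sqrtrM ?sqr_ge0 // mulr_sumr.
by congr Num.sqrt; apply: eq_bigr => i _; rewrite !mxE; ring.
Qed.

Lemma edist_collinear s t (v : 'rV[R]_2) :
  edist (s *: v) (t *: v) = `|s - t| * edist v 0.
Proof.
rewrite /edist -sqrtr_sqr -sqrtrM ?sqr_ge0 // mulr_sumr.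
by congr Num.sqrt; apply: eq_bigr => i _; rewrite !mxE; ring.
Qed.

Lemma edistC (v w : 'rV[R]_2) : edist v w = edist w v.
Proof. by congr Num.sqrt; apply: eq_bigr => i _; rewrite -sqrrN opprB. Qed.

Let vec2 s t : 'rV[R]_2 := \row_i (if i == 0 then s else t).

Let edist_vec2 s t s' t' :
  edist (vec2 s t) (vec2 s' t') = Num.sqrt ((s - s') ^+ 2 + (t - t') ^+ 2).
Proof. by rewrite /edist !big_ord_recl big_ord0 !mxE /= addr0. Qed.

Lemma euclidean_triangle a b c :
    0 <= a -> 0 <= b -> 0 <= c -> a <= b + c -> b <= c + a -> c <= a + b ->
  exists p q : 'rV[R]_2, [/\ edist 0 p = a, edist p q = c & edist q 0 = b].
Proof.
move=> a0 b0 c0 abc bca cab.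
have -> : (0 : 'rV[R]_2) = vec2 0 0 by apply/rowP => i; rewrite !mxE if_same.
have [aE|a_neq0] := eqVneq a 0.
  have bc : b = c by apply/eqP; rewrite eq_le; apply/andP; split; lra.
  exists (vec2 0 0), (vec2 b 0); rewrite !edist_vec2 -bc !subr0 sub0r sqrrN.
  by rewrite !expr0n /= !addr0 sqrtr0 sqrtr_sqr ger0_norm.
have a_gt0 : 0 < a by rewrite lt_def a_neq0.
(* Law of cosines: [u] is the first coordinate of the third vertex when the side [a] lies on the
   first axis. *)
pose u := (a ^+ 2 + b ^+ 2 - c ^+ 2) / (2 * a).
have uE : 2 * a * u = a ^+ 2 + b ^+ 2 - c ^+ 2 by rewrite /u; field.
have h0 : 0 <= b ^+ 2 - u ^+ 2.
  suff : 0 <= (2 * a) ^+ 2 * (b ^+ 2 - u ^+ 2).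
    by rewrite pmulr_rge0 // exprn_gt0 // mulr_gt0.
  (* Heron's formula: both sides are 16 times the squared area. *)
  have -> : (2 * a) ^+ 2 * (b ^+ 2 - u ^+ 2) =
      ((a + b) ^+ 2 - c ^+ 2) * (c ^+ 2 - (a - b) ^+ 2).
    by rewrite mulrBr -[in X in _ - X]exprMn uE; ring.
  rewrite !subr_sqr; apply: mulr_ge0; apply: mulr_ge0; lra.
exists (vec2 a 0), (vec2 u (Num.sqrt (b ^+ 2 - u ^+ 2))).
rewrite !edist_vec2 !subr0 !sub0r sqrrN expr0n addr0 sqrrN sqr_sqrtr //.
rewrite (_ : u ^+ 2 + _ = b ^+ 2); last by ring.
rewrite (_ : _ + (b ^+ 2 - _) = c ^+ 2); last first.
  have -> : c ^+ 2 = a ^+ 2 + b ^+ 2 - 2 * a * u by rewrite uE; ring.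
  by ring.
by rewrite !sqrtr_sqr !ger0_norm.
Qed.
End EuclideanComparison.

(** * Coning along geodesics in a CAT(0) space *)

Section Coning.
Context {R : realType} {X : metricType R}.
Hypothesis hX : CAT0 X.
Variable c : X -> X -> R -> X.
Hypothesis cP : forall x y, geodesic x y (c x y).
Implicit Types (x y p q : X) (s t u : R) (C : set X).

(** [CAT0] orients the sides of a triangle cyclically, whereas the two sides compared in a coning
    both start at the apex. *)
Lemma geodesic_segment_sym x y S : geodesic_segment x y S -> geodesic_segment y x S.
Proof.
move=> [g [g0 g1 gd] ->]; set d := mdist x y in g1 gd *.
have rev t : t \in `[0, d] -> d - t \in `[0, d].
  by rewrite !in_itv /= => /andP[? ?]; apply/andP; split; lra.
rewrite /geodesic_segment /geodesic (metric_sym y x) -/d.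
exists (fun t => g (d - t)).
  split; rewrite ?subr0 ?subrr // => s t /rev sd /rev td.
  by rewrite gd // distrC; congr `|_|; ring.
apply/seteqP; split => _ [t /= /rev td <-]; exists (d - t) => //=.
by rewrite opprB addrC subrK.
Qed.

Let clamp u : R := Num.max 0 (Num.min 1 u).

Let clamp_itv u : 0 <= clamp u <= 1.
Proof. by rewrite /clamp le_max lexx /= ge_max ler01 ge_min lexx. Qed.

Let clamp_dist u v : `|clamp u - clamp v| <= `|u - v|.
Proof.
have := ler_norm (u - v); have := ler_norm (v - u); rewrite distrC ler_norml.
rewrite /clamp; case: (leP 1 u) => ?; case: (leP 1 v) => ?;
  case: (leP (0 : R) 1) => ?;
  case: (leP 0 u) => ?; case: (leP 0 v) => ?; move=> ? ?; apply/andP; split; lra.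
Qed.

(* Runs from p at time 0 to the apex y at time 1; constant outside [0, 1]. *)
Definition coning y p u : X := c y p ((1 - clamp u) * mdist y p).

Let apex_time y p u : (1 - clamp u) * mdist y p \in `[0, mdist y p].
Proof.
have /andP[? ?] := clamp_itv u.
by rewrite in_itv /= mulr_ge0 ?ler_piMl ?mdist_ge0 //; lra.
Qed.

Lemma coning_le0 y p u : u <= 0 -> coning y p u = p.
Proof.
move=> u0; have [_ cp _] := cP y p; rewrite /coning.
have -> : clamp u = 0 by apply: max_idPl; rewrite ge_min u0 orbT.
by rewrite subr0 mul1r.
Qed.

Lemma coning_ge1 y p u : 1 <= u -> coning y p u = y.
Proof.
move=> u1; have [cy _ _] := cP y p; rewrite /coning.
have -> : clamp u = 1 by rewrite /clamp (min_idPl u1); apply/max_idPr.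
by rewrite subrr mul0r.
Qed.

Lemma coning_convex C y p u :
  geodesically_convex C -> C y -> C p -> C (coning y p u).
Proof.
move=> Ccvx Cy Cp; apply: (Ccvx _ _ (c y p @` `[0, mdist y p]) Cy Cp).
  by exists (c y p).
by exists ((1 - clamp u) * mdist y p) => //; exact: apex_time.
Qed.

Lemma mdist_coning_time y p u v :
  mdist (coning y p u) (coning y p v) <= `|u - v| * mdist y p.
Proof.
have [_ _ cd] := cP y p; rewrite /coning cd ?apex_time //.
rewrite -mulrBl normrM (ger0_norm (mdist_ge0 _ _)) ler_wpM2r ?mdist_ge0 //.
have -> : 1 - clamp u - (1 - clamp v) = clamp v - clamp u by ring.
by rewrite distrC.
Qed.

(* Compare with a Euclidean triangle whose vertex corresponding to y is the
   origin: there the coning is a homothety of ratio at most 1. *)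
Lemma mdist_coning y p q u : mdist (coning y p u) (coning y q u) <= mdist p q.
Proof.
have /andP[u0 u1] := clamp_itv u; set w := 1 - clamp u.
have w0 : 0 <= w by rewrite /w; lra.
have w1 : w <= 1 by rewrite /w; lra.
have [p' [q' [yp' pq' qy']]] : exists p' q' : 'rV[R]_2,
    [/\ edist 0 p' = mdist y p, edist p' q' = mdist p q & edist q' 0 = mdist q y].
  apply: euclidean_triangle; rewrite ?mdist_ge0 //.
  - by rewrite (metric_sym q y) (metric_sym p q); exact: metric_triangle.
  - by rewrite (metric_sym p q) (metric_sym y p); exact: metric_triangle.
  - by rewrite (metric_sym q y) (metric_sym y p); exact: metric_triangle.
have [_ CAT] := hX.
have seg x z : geodesic_segment x z (c x z @` `[0, mdist x z]) by exists (c x z).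
have tri : comparison_triangle y p q 0 p' q' by split.
have [cy cp cpd] := cP y p; have [cy' cq cqd] := cP y q.
have itv0 x z : 0 \in `[0, mdist x z] by rewrite in_itv /= lexx mdist_ge0.
have itv1 x z : mdist x z \in `[0, mdist x z] by rewrite in_itv /= lexx mdist_ge0.
have := CAT _ _ _ _ _ _ _ _ _ (seg y p) (seg p q)
  (geodesic_segment_sym (seg y q)) tri (coning y p u) (coning y q u)
  (w *: p') (w *: q').
move=> /(_ _ _)/le_trans; apply.
- apply: Or31; split.
  + by exists (w * mdist y p) => //; exact: apex_time.
  + by exists w; rewrite /= ?in_itv /= ?w0 // scaler0 add0r.
  + rewrite -[0](scale0r p') edist_collinear sub0r normrN edistC yp'.
    by rewrite -{2}cy cpd ?apex_time // sub0r normrN normrM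
      (ger0_norm (mdist_ge0 _ _)).
- apply: Or33; split.
  + by exists (w * mdist y q) => //; exact: apex_time.
  + exists (1 - w); first by rewrite /= in_itv /=; lra.
    by rewrite scaler0 addr0 subKr.
  + rewrite -{1}[q']scale1r edist_collinear qy'.
    rewrite -{2}cq cqd ?apex_time // (metric_sym q y) -{2}[mdist y q]mul1r -mulrBl.
    by rewrite normrM (ger0_norm (mdist_ge0 _ _)).
- by rewrite edistZ pq' ler_piMl ?mdist_ge0 // ger0_norm.
Qed.

Lemma coning_continuous (T : topologicalType) (h : T -> X) (w : T -> R) y :
  continuous h -> continuous w -> continuous (fun z => coning y (h z) (w z)).
Proof.
move=> hc wc z; apply/metricType_numDomainType.cvgrPdist_lt => e e0.
have e20 : 0 < e / 2 by rewrite divr_gt0.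
(* The added 1 allows division even when [h z] is the apex. *)
have d0 : 0 < mdist y (h z) + 1 by rewrite ltr_wpDl ?mdist_ge0.
have hnear := metricType_numDomainType.cvgr_dist_lt (hc z) e20.
have wnear : \forall s \near z, `|w z - w s| < e / 2 / (mdist y (h z) + 1).
  by have /cvgrPdist_lt := wc z; apply; rewrite divr_gt0.
near=> s.
apply: le_lt_trans (metric_triangle _ (coning y (h z) (w s)) _) _.
rewrite [e]splitr ler_ltD //; last first.
  by apply: le_lt_trans (mdist_coning _ _ _ _) _; near: s; exact: hnear.
apply: le_trans (mdist_coning_time _ _ _ _) _.
have : `|w z - w s| < e / 2 / (mdist y (h z) + 1) by near: s; exact: wnear.
rewrite ltr_pdivlMr // => /ltW; apply: le_trans.
by rewrite ler_wpM2l // lerDl.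
Unshelve. all: by end_near.
Qed.

Definition iterated_coning (I : Type) (x : I -> X) p (w : I -> R) (ks : seq I) : X :=
  foldl (fun p k => coning (x k) p (w k)) p ks.

Lemma iterated_coning_continuous (T : topologicalType) (I : Type) (x : I -> X)
    (h : T -> X) (w : T -> I -> R) (ks : seq I) :
    continuous h -> (forall k, continuous (w ^~ k)) ->
  continuous (fun z => iterated_coning x (h z) (w z) ks).
Proof.
move=> hc wc; elim: ks h hc => //= k ks IH h hc.
by apply: (IH (fun z => coning (x k) (h z) (w z k))); exact: coning_continuous.
Qed.

(* A weight >= 1 resets the point to a vertex, so that the starting point p is
   forgotten. *)
Lemma iterated_coning_convex (I : eqType) (x : I -> X) p (w : I -> R)
    (ks : seq I) C :
    geodesically_convex C -> (forall k, 0 < w k -> C (x k)) ->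
    C p \/ (exists2 k, k \in ks & 1 <= w k) ->
  C (iterated_coning x p w ks).
Proof.
move=> Ccvx Cx; elim: ks p => [|k ks IH] p /=; first by case=> // -[].
move=> Cpw; apply: IH.
have [wk1|wk1] := leP 1 (w k).
  by left; rewrite coning_ge1 //; apply: Cx; apply: lt_le_trans wk1.
case: Cpw => [Cp|[j]]; last first.
  rewrite inE => /orP[/eqP->|jks wj]; first by rewrite leNgt wk1.
  by right; exists j.
left; have [wk0|wk0] := leP (w k) 0; first by rewrite coning_le0.
by apply: coning_convex => //; exact: Cx.
Qed.

End Coning.

(** * The intersection theorem *)

Lemma coned_kkm (R : realType) (X : metricType R) (hX : CAT0 X) (n : nat)
    (x : 'I_n.+1 -> X) (A : 'I_n.+1 -> set X) :
    (forall i, closed (A i)) ->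
    (forall J : set 'I_n.+1, convex_hull (x @` J) `<=` \bigcup_(i in J) A i) ->
  exists p, forall i, A i p.
Proof.
move=> Acl hullA; have [geod _] := hX.
have /choice[c cP] : forall p, exists c : X -> R -> X, forall q, geodesic p q (c q).
  by move=> p; have [c cP] := choice (geod p); exists c.
(* On the simplex these weights add up to [n.+1], so one of them is at least 1 and [g v] forgets its
   starting point [x ord0]. *)
pose w (v : 'rV[R]_n.+1) (k : 'I_n.+1) : R := n.+1%:R * v ord0 k.
pose g v := iterated_coning c x (x ord0) (w v) (enum 'I_n.+1).
have g_continuous : continuous g.
  apply: (iterated_coning_continuous hX cP) => [|k v]; first exact: cst_continuous.
  exact: (cvgM (cvg_cst _) (@coord_continuous R 1 n.+1 ord0 k v)).
have [|v v0 v1|v Av] := @kkm R n (fun i => g @^-1` A i).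
- by move=> i; have /continuous_closedP := g_continuous; apply.
- suff /hullA[i /= vi] : convex_hull (x @` [set j | 0 < v ord0 j]) (g v) by exists i.
  move=> C [Ccvx xC]; apply: (iterated_coning_convex cP Ccvx) => [k|].
    by rewrite /w pmulr_rgt0 ?ltr0n // => vk; apply: xC; exists k.
  right; apply: contrapT => small.
  have wlt1 k : w v k < 1.
    rewrite ltNge; apply/negP => wk; apply: small.
    by exists k => //; rewrite mem_enum.
  have : \sum_k w v k < n.+1%:R.
    have -> : n.+1%:R = \sum_(k < n.+1) (1 : R) by rewrite sumr_const card_ord.
    by apply: ltr_sum => //; apply/hasP; exists ord0; rewrite ?mem_index_enum.
  by rewrite -mulr_sumr v1 mulr1 ltxx.
- by exists (g v).
Qed.

Theorem theorem3p3 (R : realType) (X : completeMetricType R) (hX : CAT0 X)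
    (K : set X) (K0 : K !=set0) (Kcl : closed K) (Kcvx : geodesically_convex K)
    (G : X -> set X) (GK : forall x, K x -> G x `<=` K)
    (Gcl : forall x, K x -> closed (G x))
    (hG : forall D : set X, finite_set D -> D `<=` K ->
      convex_hull D `<=` \bigcup_(x in D) G x) :
  finI K G /\
  ((exists2 x0, K x0 & compact (G x0)) -> \bigcap_(x in K) G x !=set0).
Proof.
have finIG : finI K G.
  (* The empty intersection is the whole space, which contains the base point. *)
  move=> E EK; case: (posnP (size E)) => [/size0nil E0|E_gt0].
    by exists point => y yE; have : y \in (E : seq X) := yE; rewrite E0.
  pose x0 : X := point.
  pose x (i : 'I_(size E).-1.+1) := nth x0 E i.
  have xE i : x i \in E by apply: mem_nth; rewrite -[ltnRHS](prednK E_gt0).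
  have xK i : K (x i) by apply/set_mem/EK/xE.
  have [|J z|p Gp] := coned_kkm hX (x := x) (A := G \o x).
  - by move=> i; exact: Gcl.
  - case/hG => [||_ [i Ji <-] Gz]; last by exists i.
      exact/finite_image/finite_finset.
    by move=> _ [i _ <-].
  exists p => y /= yE; have ltyE : (index y E < (size E).-1.+1)%N.
    by rewrite prednK // index_mem.
  by have := Gp (Ordinal ltyE); rewrite /= /x /= nth_index.
(* Compactness is applied to the relatively closed sets [G x0]&[G x]; a finite subfamily meets
   because [x0] can be added to its indices. *)
split=> // -[x0 Kx0]; rewrite compact_In0 => Gx0.
have [|E EK|p Gp] := Gx0 X K (fun x => G x0 `&` G x).
- by exists G.
- have [|p Gp] := finIG (x0 |` E)%fset.
    by move=> y; rewrite in_fset1U => /orP[/eqP->|/EK //]; exact: mem_set.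
  by exists p => y /= yE; split; apply: Gp; rewrite /= in_fset1U ?eqxx // yE orbT.
- by exists p => y /Gp[].
Qed.
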